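(* Let $H$ be a graph with $\mathrm{girth}(H)\ge 5$. Then $H$ is a shortest path graph if and only if each nontrivial connected component of $H$ is a path or a cycle of even length greater than $5$.
   Context: Graphs are finite and simple. For a graph $G$ with distinct vertices $a,b$, a shortest $a,b$-path ($a,b$-geodesic) is a path between $a$ and $b$ of length $d_G(a,b)$. The shortest path graph $S(G,a,b)$ is the graph whose vertices are the shortest $a,b$-paths in $G$, two of them being adjacent if and only if the corresponding paths differ in exactly one vertex. A graph $H$ is called a shortest path graph if there exist a graph $G$ and distinct $a,b\in V(G)$ with $S(G,a,b)\cong H$. The girth of a graph is the length of its shortest cycle, and is infinite for a graph with no cycles. A component is nontrivial if it has more than one vertex. *)

(* Defs.v *)
From mathcomp Require Import all_boot.

Set Implicit Arguments.
Unset Strict Implicit.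
Unset Printing Implicit Defensive.

Record sgraph := SGraph {
  vertex :> finType;
  edge : rel vertex;
  edge_sym : symmetric edge;
  edge_irr : irreflexive edge }.

Arguments edge {s}.

Definition isomorphic (G H : sgraph) : Prop :=
  exists2 f : G -> H, bijective f & {mono f : x y / edge x y}.

Section Induced.
Variables (G : sgraph) (A : {set G}).

Definition induced_edge : rel {x : G | x \in A} :=
  fun x y => edge (val x) (val y).

Lemma induced_edge_sym : symmetric induced_edge.
Proof. by move=> x y; rewrite /induced_edge edge_sym. Qed.

Lemma induced_edge_irr : irreflexive induced_edge.
Proof. by move=> x; rewrite /induced_edge edge_irr. Qed.

Definition induced : sgraph := SGraph induced_edge_sym induced_edge_irr.
End Induced.

Definition components (G : sgraph) : {set {set G}} :=
  [set [set y | connect edge x y] | x : G].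

(* Number of vertices, not length: path_graph n has n vertices. *)
Section PathCycleGraph.
Variable n : nat.

Definition path_edge : rel 'I_n :=
  fun i j => (i.+1 == j :> nat) || (j.+1 == i :> nat).

Lemma path_edge_sym : symmetric path_edge.
Proof. by move=> i j; rewrite /path_edge orbC. Qed.

Lemma path_edge_irr : irreflexive path_edge.
Proof. by move=> i; rewrite /path_edge orbb gtn_eqF. Qed.

Definition path_graph : sgraph := SGraph path_edge_sym path_edge_irr.

(* This is the cycle of length n only for n >= 3; the conjunct i != j matters
   only for n = 1. *)
Definition cycle_edge : rel 'I_n :=
  fun i j => (i != j) && ((i.+1 %% n == j) || (j.+1 %% n == i)).

Lemma cycle_edge_sym : symmetric cycle_edge.
Proof. by move=> i j; rewrite /cycle_edge eq_sym orbC. Qed.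

Lemma cycle_edge_irr : irreflexive cycle_edge.
Proof. by move=> i; rewrite /cycle_edge eqxx. Qed.

Definition cycle_graph : sgraph := SGraph cycle_edge_sym cycle_edge_irr.
End PathCycleGraph.

Section Girth.
Variable G : sgraph.

Definition is_cycle (c : seq G) : bool := (2 < size c) && ucycleb edge c.

Definition has_cycle (n : nat) : bool := [exists c : n.-tuple G, is_cycle c].

(* None stands for infinity. A cycle has at most #|G| vertices, so the search
   range is sufficient. *)
Definition girth : option nat :=
  let n := find has_cycle (iota 0 #|G|.+1) in
  if n <= #|G| then Some n else None.

Definition girth_geq (k : nat) : bool :=
  if girth is Some n then k <= n else true.
End Girth.

(* Number of positions at which s and t differ; zip truncates to the shorter
   sequence, but this is only used for sequences of equal size. *)
Definition num_diff (T : eqType) (s t : seq T) : nat :=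
  count (fun uv => uv.1 != uv.2) (zip s t).

Lemma num_diff_sym (T : eqType) (s t : seq T) : num_diff s t = num_diff t s.
Proof.
rewrite /num_diff; elim: s t => [|x s IHs] [|y t] //=.
by rewrite eq_sym IHs.
Qed.

Lemma num_diff_refl (T : eqType) (s : seq T) : num_diff s s = 0.
Proof. by rewrite /num_diff; elim: s => //= x s ->; rewrite eqxx. Qed.

Section ShortestPaths.
Variables (G : sgraph) (a b : G).

(* A path is encoded by the full sequence of its vertices, listed from a to b,
   both included; its length is therefore (size s).-1. *)
Definition ab_path (s : seq G) : bool :=
  if s is x :: p then [&& x == a, last x p == b, path edge x p & uniq s]
  else false.

(* The value is #|G| when a and b lie in different components; there is then
   no path, hence no shortest path, from a to b. *)
Definition dist : nat :=
  find (fun n => [exists s : n.+1.-tuple G, ab_path s]) (iota 0 #|G|).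

Definition geodesic (s : seq G) : bool :=
  ab_path s && ((size s).-1 == dist).

(* A path has at most #|G| vertices, so that sequences of size at most #|G|
   account for all of them. *)
Definition spg_vertex : finType := {s : #|G|.-bseq G | geodesic s}.

Definition spg_edge : rel spg_vertex := fun s t =>
  num_diff (val s : seq G) (val t) == 1.

Lemma spg_edge_sym : symmetric spg_edge.
Proof. by move=> s t; rewrite /spg_edge num_diff_sym. Qed.

Lemma spg_edge_irr : irreflexive spg_edge.
Proof. by move=> s; rewrite /spg_edge num_diff_refl. Qed.

Definition shortest_path_graph : sgraph := SGraph spg_edge_sym spg_edge_irr.
End ShortestPaths.

Definition is_shortest_path_graph (H : sgraph) : Prop :=
  exists (G : sgraph) (a b : G),
    a != b /\ isomorphic (shortest_path_graph a b) H.

(* Main.v *)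
Require Import Defs.
From mathcomp Require Import all_boot.
From mathcomp Require Import zify.

(* In a shortest path graph, label an edge by the index at which its two
   geodesics differ. At a vertex of a graph of girth at least 5, two edges with
   the same label would span a triangle and two edges with non-consecutive
   labels would span a 4-cycle, so the parity of the label is a proper
   2-edge-colouring. Hence degrees are at most 2 and all cycles are even.
   Conversely, paths and even cycles of length at least 6 are line graphs of
   bipartite graphs with sides U and V; joining a new vertex a to all of U and a
   new vertex b to all of V, the a,b-geodesics a,u,v,b correspond to the edges
   uv, and differ in exactly one vertex when these edges are adjacent. *)

Set Implicit Arguments.
Unset Strict Implicit.
Unset Printing Implicit Defensive.

(** * Preliminaries on finite types and isomorphisms *)

Lemma uniq_leq_card (T : finType) (s : seq T) : uniq s -> size s <= #|T|.
Proof. by move/card_uniqP <-; apply: max_card. Qed.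

Lemma modn_ordS n (i : 'I_n) : i.+1 %% n = if i.+1 == n then 0 else i.+1.
Proof.
have := ltn_ord i; case: eqP => [-> | ne lt_in]; first by rewrite modnn.
by rewrite modn_small //; lia.
Qed.

Lemma inj_surj_bij (T : Type) (U : finType) (f : T -> U) :
  injective f -> (forall y, exists x, f x = y) -> bijective f.
Proof.
move=> f_inj f_surj; have [g fgK] := fin_all_exists f_surj.
by exists g => // x; apply: f_inj; rewrite fgK.
Qed.

Lemma isomorphic_sym (G H : sgraph) : isomorphic G H -> isomorphic H G.
Proof.
case=> f [g fK gK] f_mono; exists g; first by exists f.
by move=> x y; rewrite -f_mono !gK.
Qed.

Lemma isomorphic_induced (G K : sgraph) (C : {set G}) (h : K -> G) :
  injective h -> (forall x, reflect (exists k, h k = x) (x \in C)) ->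
  {mono h : x y / edge x y} -> isomorphic (induced C) K.
Proof.
move=> h_inj hC h_mono; apply: isomorphic_sym.
have h_in k : h k \in C by apply/hC; exists k.
exists (fun k => Sub (h k) (h_in k) : induced C); last first.
  by move=> x y; rewrite /= /induced_edge /= h_mono.
apply: inj_surj_bij => [x y /(congr1 val)/h_inj // | [x xC]].
by have [k hk] := hC x xC; exists k; apply: val_inj.
Qed.

(** * Geodesics *)

Section Geodesics.
Variables (G : sgraph) (a b : G).

Lemma dist_le (s : seq G) : ab_path a b s -> dist a b <= (size s).-1.
Proof.
case: s => // x p abp; rewrite /dist leqNgt; apply/negP => lt_find.
have p_lt : size p < #|G|.
  by case/and4P: abp => _ _ _ /uniq_leq_card.
have := before_find 0 lt_find; rewrite nth_iota // add0n => /existsP[].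
by exists (in_tuple (x :: p)).
Qed.

(** Any path puts [dist a b] below [#|G|], the default value of the search, so the search has
    succeeded. *)
Lemma ex_geodesic (s : seq G) : ab_path a b s -> exists t : seq G, geodesic a b t.
Proof.
move=> s_path; have lt_dist : dist a b < #|G|.
  apply: leq_ltn_trans (dist_le s_path) _.
  case: s s_path => // x p /and4P[_ _ _ p_uniq]; exact: uniq_leq_card p_uniq.
have : dist a b < size (iota 0 #|G|) by rewrite size_iota.
rewrite -has_find => /(nth_find 0); rewrite nth_iota //.
case/existsP=> t t_path; exists t.
by rewrite /geodesic t_path size_tuple /= eqxx.
Qed.

Lemma geodesic_size (s : seq G) : geodesic a b s -> size s = (dist a b).+1.
Proof. by case: s => // x p /andP[_ /eqP /= ->]. Qed.

Lemma geodesic_leq_card (s : seq G) : geodesic a b s -> size s <= #|G|.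
Proof. by case: s => // x p /andP[/and4P[_ _ _ /uniq_leq_card]]. Qed.

(* A walk of length [dist a b] is a path: shortening it cannot drop a vertex. *)
Lemma geodesicP (s : seq G) :
  reflect [/\ size s = (dist a b).+1, nth a s 0 = a, nth a s (dist a b) = b &
             forall i, i < dist a b -> edge (nth a s i) (nth a s i.+1)]
          (geodesic a b s).
Proof.
apply: (iffP idP) => [geo | []].
  have sz := geodesic_size geo; case: s sz geo => // x p [sz].
  case/andP=> /and4P[/eqP xa /eqP pb /(pathP a) p_path _] _; subst x.
  by split; rewrite -?sz // -last_nth.
case: s => // x p [sz] /= -> lastb p_edge.
have last_b : last a p = b by rewrite (last_nth a) sz.
have p_path : path edge a p by apply/(pathP a) => i; rewrite sz => /p_edge.
rewrite /geodesic /= !eqxx last_b eqxx p_path sz eqxx andbT /=.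
case: (shortenP p_path) last_b => q q_path q_uniq q_sub last_q.
have: dist a b <= size q.
  by apply: (@dist_le (a :: q)); rewrite /= last_q !eqxx q_path.
rewrite -sz => le_pq.
apply: (@leq_size_uniq _ _ (a :: p) q_uniq) => // y; rewrite !inE.
by case/orP=> [-> // | /q_sub ->]; rewrite orbT.
Qed.

End Geodesics.

(** Past their common end both sequences read [x0], so neither [i] nor [k] needs a bound. *)
Lemma num_diff1P (T : eqType) (x0 : T) (s t : seq T) : size s = size t ->
  reflect (exists i, forall k, (nth x0 s k != nth x0 t k) = (k == i))
          (num_diff s t == 1).
Proof.
rewrite /num_diff => sz.
have has0 (s' t' : seq T) : size s' = size t' ->
    reflect (s' = t') (count (fun uv => uv.1 != uv.2) (zip s' t') == 0).
  elim: s' t' => [|x s' IH] [|y t'] //= => [_|[/IH{}IH]]; first by constructor.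
  case: (eqVneq x y) => [->|ne] /=; last first.
    by constructor; case=> /eqP; rewrite (negbTE ne).
  by rewrite add0n; apply: (iffP IH) => [-> // | []].
elim: s t sz => [|x s IH] [|y t] //= => [_|[sz]].
  by constructor=> -[i /(_ i)]; rewrite !nth_nil !eqxx.
case: (eqVneq x y) => [->|ne] /=.
  rewrite add0n; apply: (iffP (IH t sz)) => -[i Hi].
    by exists i.+1 => -[|k] /=; rewrite ?eqxx.
  case: i Hi => [/(_ 0)|i Hi]; first by rewrite /= eqxx.
  by exists i => k; rewrite (Hi k.+1).
rewrite add1n eqSS; apply: (iffP (has0 s t sz)) => [->|[i Hi]].
  by exists 0 => -[|k] /=; rewrite ?ne ?eqxx.
have i0 : i = 0 by apply/eqP; rewrite eq_sym -Hi.
apply: (@eq_from_nth _ x0) => // k _; apply/eqP; move: (Hi k.+1).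
by rewrite i0 /= => /negbFE.
Qed.

(** * Girth *)

Section Girth5.
Variables (G : sgraph) (girthG : girth_geq G 5).

Lemma cycle_size_ge5 (c : seq G) : is_cycle c -> 5 <= size c.
Proof.
move=> c_cyc; have c_le : size c <= #|G|.
  by case/andP: c_cyc => _ /andP[_ /uniq_leq_card].
have le_find : find (has_cycle G) (iota 0 #|G|.+1) <= size c.
  rewrite leqNgt; apply/negP => /(before_find 0).
  rewrite nth_iota // add0n => /existsP[]; by exists (in_tuple c).
move: girthG; rewrite /girth_geq /girth (leq_trans le_find c_le) => /leq_trans.
exact.
Qed.

Lemma no_triangle (x y z : G) : edge x y -> edge y z -> edge z x -> False.
Proof.
move=> xy yz zx; suff /cycle_size_ge5 : is_cycle [:: x; y; z] by [].
rewrite /is_cycle /ucycleb /= xy yz zx !inE negb_or !andbT /=.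
by apply/andP; split; [apply/andP; split|]; apply: contraTneq isT => E;
   rewrite E ?edge_irr in xy yz zx.
Qed.

Lemma no_square (x y z w : G) : x != z -> y != w ->
  edge x y -> edge y z -> edge z w -> edge w x -> False.
Proof.
move=> xz yw xy yz zw wx; suff /cycle_size_ge5 : is_cycle [:: x; y; z; w] by [].
rewrite /is_cycle /ucycleb /= xy yz zw wx !inE !negb_or xz yw !andbT /=.
by apply/and3P; split; [apply/andP; split| |]; apply: contraTneq isT => E;
   rewrite E ?edge_irr in xy yz zw wx.
Qed.

End Girth5.

(** * Edge colouring of a shortest path graph *)

Definition edge_2coloring (G : sgraph) (col : G -> G -> bool) : Prop :=
  (forall x y, edge x y -> col x y = col y x) /\
  (forall x y z, edge x y -> edge x z -> y != z -> col x y != col x z).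

Lemma spg_edge_2coloring (H : sgraph) : girth_geq H 5 ->
  is_shortest_path_graph H -> exists col : H -> H -> bool, edge_2coloring col.
Proof.
move=> girthH [G [a [b [_ /isomorphic_sym [f f_bij f_mono]]]]].
pose pos x k := nth a (val (val (f x)) : seq G) k.
have geo x : geodesic a b (val (val (f x)) : seq G) by exact: valP (f x).
have sz x := geodesic_size (geo x).
have edgeP x y :
    reflect (exists i, forall k, (pos x k != pos y k) = (k == i)) (edge x y).
  by rewrite -f_mono; apply: num_diff1P; rewrite !sz.
have edgeI x y i : (forall k, (pos x k != pos y k) = (k == i)) -> edge x y.
  by move=> Hi; apply/edgeP; exists i.
have pos_inj x y : pos x =1 pos y -> x = y.
  move=> xy; apply: (bij_inj f_bij); do 2!apply: val_inj.
  by apply: (@eq_from_nth _ a) => [|k _]; [rewrite !sz | exact: xy].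
have [lab labP] : exists lab : H * H -> nat, forall xy, edge xy.1 xy.2 ->
    forall k, (pos xy.1 k != pos xy.2 k) = (k == lab xy).
  apply: (fin_all_exists (P := fun xy (i : nat) => edge xy.1 xy.2 -> forall k,
    (pos xy.1 k != pos xy.2 k) = (k == i))) => -[x y] /=.
  by case: edgeP => [[i Hi]|_]; [exists i | exists 0].
exists (fun x y => odd (lab (x, y))); split=> [x y xy | x y z xy xz ne_yz].
  congr odd; apply/eqP; rewrite -(labP (y, x)) /=; last by rewrite edge_sym.
  by rewrite eq_sym (labP (x, y)) //= eqxx.
have := labP (x, y) xy; have := labP (x, z) xz => /=.
move: (lab (x, y)) (lab (x, z)) => i j Hj Hi.
have Ei k : k != i -> pos y k = pos x k.
  by rewrite -Hi negbK => /eqP.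
have Ej k : k != j -> pos z k = pos x k.
  by rewrite -Hj negbK => /eqP.
(* Equal labels: [y] and [z] agree off [i], and being distinct they differ at [i], which closes a
   triangle. *)
case: (eqVneq i j) => [ij | ne_ij].
  case: (@no_triangle _ girthH x y z) => //; last by rewrite edge_sym.
  apply: (edgeI _ _ i) => k; case: (eqVneq k i) => [-> | ki].
    apply: contraNneq ne_yz => yz; apply/eqP/pos_inj => l.
    by case: (eqVneq l i) => [-> // | li]; rewrite Ei // Ej // -ij.
  by rewrite Ei // Ej -?ij // eqxx.
case: (boolP ((i == j.+1) || (j == i.+1))) => [/orP[]/eqP-> /=|]; rewrite ?oddS.
- by case: (odd j).
- by case: (odd i).
rewrite negb_or => /andP[ne_iSj ne_jSi].
(* The fourth corner of the square: [x] with both changes made, that of [y] at [i] and that of [z]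
   at [j]. *)
pose w := mkseq (fun k => if k == i then pos y k else pos z k) (dist a b).+1.
have w_nth k : k <= dist a b -> nth a w k = if k == i then pos y k else pos z k.
  by move=> le_k; rewrite nth_mkseq.
have /geodesicP[_ y0 yb y_edge] := geo y.
have /geodesicP[_ z0 zb z_edge] := geo z.
have w_geo : geodesic a b w.
  apply/geodesicP; split=> [|||k lt_k].
  - by rewrite size_mkseq.
  - by rewrite w_nth //; case: ifP.
  - by rewrite w_nth //; case: ifP.
  (* As [i] and [j] are not consecutive, a step of [w] at position [i] is a step of [y], and every
     other one is a step of [z]. *)
  rewrite (w_nth k (ltnW lt_k)) (w_nth _ lt_k); case: (eqVneq k i) => [ki | ne_ki].
    rewrite gtn_eqF ?ki //.
    by rewrite Ej 1?eq_sym // -(Ei i.+1) ?gtn_eqF // y_edge // -ki.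
  case: (eqVneq k.+1 i) => [Ski | _]; last exact: z_edge.
  rewrite Ej; last by apply: contraNneq ne_iSj => <-; rewrite Ski.
  by rewrite -(Ei k) // y_edge.
have [g fK gK] := f_bij.
have w_sz := geodesic_leq_card w_geo.
pose W := g (exist (fun s : #|G|.-bseq G => geodesic a b s) (Bseq w_sz) w_geo).
have posW k : pos W k = if k == i then pos y k else pos z k.
  rewrite /pos /W gK /=; case: (leqP k (dist a b)) => [/w_nth //|lt_k].
  by rewrite !nth_default ?size_mkseq ?sz ?if_same.
case: (@no_square _ girthH x y W z) => //.
- by apply/eqP => xW; have := Hi i; rewrite xW posW !eqxx.
- apply: (edgeI _ _ j) => k; rewrite posW; case: (eqVneq k i) => [->|ki].
    by rewrite eqxx (negbTE ne_ij).
  by rewrite Ei // Hj.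
- apply: (edgeI _ _ i) => k; rewrite posW; case: (eqVneq k i) => [->|ki].
    by rewrite Ej // eq_sym Hi eqxx.
  by rewrite eqxx.
by rewrite edge_sym.
Qed.

(** * Components of 2-edge-coloured graphs *)

Section Components.
Variables (G : sgraph) (col : G -> G -> bool).
Hypothesis colP : edge_2coloring col.

Lemma edge_2coloring_degree (x y z w : G) :
  edge x y -> edge x z -> edge x w -> [|| y == z, y == w | z == w].
Proof.
move=> xy xz xw; case: eqVneq => //= yz; case: eqVneq => //= yw.
case: eqVneq => //= zw; case: colP => _ col_neq.
have := col_neq _ _ _ xy xz yz; have := col_neq _ _ _ xy xw yw.
by have := col_neq _ _ _ xz xw zw; do 3!case: (col _ _).
Qed.

(* In a path of maximal length in the component, the end vertices have no
   neighbours outside the path by maximality, and the inner vertices have none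
   by the degree bound. *)
Lemma component_spanning_path (x0 : G) :
  exists s : seq G, [/\ uniq s, sorted edge s & s =i [set y | connect edge x0 y]].
Proof.
set C := [set y | _].
pose P n := [exists s : n.-tuple G, [&& uniq s, sorted edge s & all (mem C) s]].
have P1 : P 1 by apply/existsP; exists [tuple x0]; rewrite /= inE connect0.
have P_le n : P n -> n <= #|G|.
  by case/existsP=> s /andP[/uniq_leq_card]; rewrite size_tuple.
case: (ex_maxnP (ex_intro _ 1 P1) P_le) => n /existsP[s].
case/and3P=> s_uniq s_sorted sC n_max; exists s; split=> //.
have s_max (t : seq G) :
    uniq t -> sorted edge t -> all (mem C) t -> size t <= size s.
  move=> t_uniq t_sorted t_C; rewrite size_tuple; apply: n_max.
  by apply/existsP; exists (in_tuple t); rewrite /= t_uniq t_sorted.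
have C_edge x y : x \in C -> edge x y -> y \in C.
  by rewrite !inE => Cx /connect1; apply: connect_trans.
have conn_sym := sym_connect_sym (@edge_sym G).
have n_gt0 : 0 < size s by rewrite size_tuple n_max.
move: s_uniq s_sorted sC s_max n_gt0 => {n_max}; move: (val s) => {P P1 P_le n}s.
move=> s_uniq s_sorted sC s_max n_gt0.
have s_closed : closed edge (mem s).
  apply: (intro_closed conn_sym) => x y xy xs; apply: contraT.
  rewrite -[y \in mem s]/(y \in s) => ys.
  have yC : y \in C by apply: C_edge xy; apply: (allP sC).
  case: (eqVneq x (head x s)) => [x_head | ne_head].
    have := s_max (y :: s).
    rewrite ltnn /= ys s_uniq sC yC => -> //.
    by case: (s) x_head s_sorted => //= ? ? <- ->; rewrite edge_sym xy.
  case: (eqVneq x (last x s)) => [x_last | ne_last].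
    have := s_max (rcons s y).
    rewrite size_rcons ltnn rcons_uniq ys s_uniq all_rcons sC /= yC => -> //.
    by case: (s) x_last s_sorted => //= ? ? x_last;
      rewrite rcons_path -x_last xy => ->.
  have i_lt : index x s < size s by rewrite index_mem.
  case def_i: (index x s) => [|i].
    by move: ne_head; rewrite -nth0 -def_i nth_index ?eqxx.
  have Si_lt : i.+2 < size s.
    rewrite ltn_neqAle -def_i i_lt andbT; apply: contra ne_last => /eqP si.
    by rewrite -nth_last -si nth_index.
  have /sortedP s_edge := s_sorted; have i1_lt := ltnW Si_lt.
  have def_x : x = nth x s i.+1 by rewrite -def_i nth_index.
  have := s_edge x i i1_lt; rewrite -def_x edge_sym => xu.
  have := s_edge x i.+1 Si_lt; rewrite -def_x => xv.
  have := edge_2coloring_degree xy xu xv; rewrite nth_uniq // ?(ltnW i1_lt) //.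
  rewrite ltn_eqF // orbF => /orP[]/eqP def_y;
    by rewrite def_y mem_nth ?(ltnW i1_lt) in ys.
have s0C : head x0 s \in C by apply: (allP sC); rewrite -nth0 mem_nth.
move=> y; apply/idP/idP => [/(allP sC) // | yC].
move: s0C yC; rewrite !inE conn_sym => s0x0 /(connect_trans s0x0).
by move/(closed_connect s_closed) => <-; rewrite -nth0 mem_nth.
Qed.

(** By the degree bound, a spanning path admits no further edge except one joining its two ends.
    That edge decides between path and cycle. The cycle is also given as a sequence in [G], so that
    the girth bound applies to it. *)
Lemma component_path_or_cycle (x0 : G) (C := [set y | connect edge x0 y]) :
  (exists n, isomorphic (induced C) (path_graph n)) \/
  (exists c : seq G, [/\ is_cycle c, ~~ odd (size c) &
                        isomorphic (induced C) (cycle_graph (size c))]).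
Proof.
have [s [s_uniq s_sorted sC]] := component_spanning_path x0.
pose n := size s; pose v := nth x0 s.
have v_eq i j : i < n -> j < n -> (v i == v j) = (i == j).
  by move=> lti ltj; apply: nth_uniq.
have v_edge i : i.+1 < n -> edge (v i) (v i.+1) by move: i; exact/sortedP.
(* An inner vertex already has its two path neighbours, so a chord at it would give a third one. *)
have v_chord i j : i < j -> j < n -> edge (v i) (v j) ->
    (j == i.+1) || (i == 0) && (j.+1 == n).
  move=> lt_ij lt_jn ij; case: eqVneq => //= ne_j.
  have lt_Si : i.+1 < n by lia.
  apply/andP; split.
    case: i => // i in lt_ij ij ne_j lt_Si *.
    have iSi := v_edge _ lt_Si; have := v_edge _ (ltnW lt_Si); rewrite edge_sym.
    by move/(edge_2coloring_degree ij iSi); rewrite !v_eq; lia.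
  case: eqVneq => // ne_Sj; case: j => // j in lt_ij lt_jn ij ne_j ne_Sj *.
  have jSj : edge (v j.+1) (v j.+2) by apply: v_edge; lia.
  have := v_edge _ lt_jn; rewrite edge_sym in ij; rewrite edge_sym.
  by move/(edge_2coloring_degree ij jSj); rewrite !v_eq; lia.
have v_ltE i j : i < j -> j < n -> edge (v i) (v j) =
    (j == i.+1) || [&& i == 0, j.+1 == n & edge (v 0) (v n.-1)].
  move=> lt_ij lt_jn; apply/idP/idP => [ij | /orP[/eqP ji | /and3P[/eqP-> /eqP <-]]] //.
    case/orP: (v_chord _ _ lt_ij lt_jn ij) => [-> // | /andP[/eqP i0 /eqP jn]].
    by rewrite i0 -jn /= -i0 ij eqxx !orbT.
  by rewrite ji v_edge // -ji.
have h_inj : injective (fun i : 'I_n => v i).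
  by move=> i j /eqP; rewrite v_eq // => /eqP/val_inj.
have hC x : reflect (exists i : 'I_n, v i = x) (x \in C).
  rewrite -sC; apply: (iffP idP) => [xs | [i <-]]; last exact: mem_nth.
  rewrite -index_mem in xs; exists (Ordinal xs).
  by rewrite /v nth_index // -index_mem.
(* For [n = 2] the ends are joined by the path's only edge, which closes no cycle. *)
case: (boolP ((2 < n) && edge (v 0) (v n.-1))) => [/andP[n_gt2 closing] | not_closing].
  right; exists s; split.
  - rewrite /is_cycle n_gt2 /ucycleb s_uniq andbT.
    move: s_sorted closing; rewrite edge_sym /n /v nth0 nth_last.
    by case: (s) => //= x p; rewrite rcons_path => ->.
  - have [col_sym col_neq] := colP.
    (* Colours alternate along the path. The closing edge differs in colour from the first and the
       last path edge, so these two agree and their indices 0 and [k.+1] have the same parity; hence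
       [n = k.+3] is even. *)
    have col_alt i : i.+1 < n -> col (v i) (v i.+1) = odd i (+) col (v 0) (v 1).
      elim: i => // i IH lt_i; have lt_i' := ltnW lt_i.
      have e1 := v_edge _ lt_i'; have e2 := v_edge _ lt_i.
      have ne : v i != v i.+2 by rewrite v_eq ?(ltnW lt_i') // ltn_eqF.
      have e1' : edge (v i.+1) (v i) by rewrite edge_sym.
      have := col_neq _ _ _ e1' e2 ne; rewrite (col_sym _ _ e1') IH //=.
      by case: (odd i); case: (col (v 0) _); case: (col _ _).
    have [k def_n] : exists k, n = k.+3 by exists (n - 3); lia.
    rewrite -/n def_n; rewrite def_n /= in closing.
    have v01 : edge (v 0) (v 1) by apply: v_edge; lia.
    have vk : edge (v k.+1) (v k.+2) by apply: v_edge; lia.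
    have vk' : edge (v k.+2) (v k.+1) by rewrite edge_sym.
    have closing' : edge (v k.+2) (v 0) by rewrite edge_sym.
    have ne1 : v 1 != v k.+2 by rewrite v_eq; lia.
    have ne2 : v k.+1 != v 0 by rewrite v_eq; lia.
    have := col_neq _ _ _ vk' closing' ne2; have := col_neq _ _ _ v01 closing ne1.
    rewrite (col_sym _ _ vk') (col_sym _ _ closing') (col_alt k.+1) ?def_n //=.
    by case: (odd k); case: (col (v 0) (v 1)); case: (col _ _).
  - apply: (isomorphic_induced (K := cycle_graph n)) h_inj hC _ => i j /=.
    rewrite /cycle_edge !modn_ordS -val_eqE /=; have := ltn_ord i; have := ltn_ord j.
    case: (ltngtP i j) => [lt_ij lt_jn lt_in | lt_ji lt_jn lt_in | -> _ _].
    + by rewrite v_ltE // closing; case: (i.+1 =P n); case: (j.+1 =P n); lia.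
    + by rewrite edge_sym v_ltE // closing; case: (i.+1 =P n); case: (j.+1 =P n); lia.
    + by rewrite edge_irr.
left; exists n; apply: (isomorphic_induced (K := path_graph n)) h_inj hC _.
move=> i j /=; rewrite /path_edge; have := ltn_ord i; have := ltn_ord j.
case: (ltngtP i j) => [lt_ij lt_jn lt_in | lt_ji lt_jn lt_in | -> _ _].
- by rewrite v_ltE //; case: (edge (v 0) _) not_closing => /=; lia.
- by rewrite edge_sym v_ltE //; case: (edge (v 0) _) not_closing => /=; lia.
- by rewrite edge_irr; lia.
Qed.
End Components.

(** * Line graphs of bipartite graphs *)

(* [c1] and [c2] send an edge of a simple bipartite graph to its two ends; [G]
   is the line graph of that bipartite graph. *)
Definition bipartite_line_graph (T : eqType) (G : sgraph) (c1 c2 : G -> T) : Prop :=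
  (forall x y, c1 x = c1 y -> c2 x = c2 y -> x = y) /\
  (forall x y, edge x y = (c1 x == c1 y) (+) (c2 x == c2 y)).

(** Vertex [i] stands for the edge between the points [i] and [i + 1] of a longer path; the two
    halvings number its odd and its even end. *)
Lemma path_graph_line n : exists c1 c2 : path_graph n -> nat,
  bipartite_line_graph c1 c2.
Proof.
exists (fun i : 'I_n => i./2), (fun i : 'I_n => i.+1./2); split=> [i j e1 e2 | i j].
  by apply: val_inj => /=; lia.
by rewrite /= /path_edge; lia.
Qed.

(** The same numbering around a cycle of points modulo [n]; evenness of [n] keeps the parity of
    points consistent at the wrap. *)
Lemma cycle_graph_line n : ~~ odd n -> 3 < n ->
  exists c1 c2 : cycle_graph n -> nat, bipartite_line_graph c1 c2.
Proof.
move=> n_even n_gt3.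
exists (fun i : 'I_n => i./2), (fun i : 'I_n => (i.+1 %% n)./2); split=> i j.
  rewrite !modn_ordS => e1 e2; apply: val_inj => /=.
  by move: e2; have := ltn_ord i; have := ltn_ord j;
     case: (i.+1 =P n); case: (j.+1 =P n); lia.
rewrite /= /cycle_edge !modn_ordS -val_eqE /=; have := ltn_ord i; have := ltn_ord j.
by case: (i.+1 =P n); case: (j.+1 =P n); lia.
Qed.

Lemma bipartite_line_graph_iso (G K : sgraph) (T : eqType) : isomorphic G K ->
  (exists c1 c2 : K -> T, bipartite_line_graph c1 c2) ->
  exists c1 c2 : G -> T, bipartite_line_graph c1 c2.
Proof.
case=> f f_bij f_mono [c1 [c2 [c_inj cE]]]; exists (c1 \o f), (c2 \o f).
split=> x y; last by rewrite -f_mono cE.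
by move=> e1 e2; apply: (bij_inj f_bij); apply: c_inj.
Qed.

(** Labels of different components may coincide, so each is replaced by its fibre inside the
    component. Fibres are nonempty and those from different components are disjoint; they also form
    a finite type, as the realization requires. *)
Lemma bipartite_line_graph_glue (H : sgraph) :
  (forall C, C \in components H ->
     exists c1 c2 : induced C -> nat, bipartite_line_graph c1 c2) ->
  exists c1 c2 : H -> {set H}, bipartite_line_graph c1 c2.
Proof.
move=> lineH; pose comp (x : H) := [set y | connect edge x y].
have [c cP] : exists c : {set H} -> (H -> nat) * (H -> nat),
    forall C, C \in components H -> forall x y, x \in C -> y \in C ->
      ((c C).1 x = (c C).1 y -> (c C).2 x = (c C).2 y -> x = y) /\
      edge x y = ((c C).1 x == (c C).1 y) (+) ((c C).2 x == (c C).2 y).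
  apply: (fin_all_exists (P := fun (C : {set H}) (c : (H -> nat) * (H -> nat)) =>
    C \in components H -> forall x y, x \in C -> y \in C ->
      (c.1 x = c.1 y -> c.2 x = c.2 y -> x = y) /\
      edge x y = (c.1 x == c.1 y) (+) (c.2 x == c.2 y))) => C.
  case: (boolP (C \in components H)) => [/lineH[c1 [c2 [c_inj cE]]] | _]; last first.
    by exists (fun=> 0, fun=> 0).
  (* Extension by 0 outside [C] gives the labellings a type independent of [C], which the finite
     choice requires. *)
  pose ext (f : induced C -> nat) x := oapp f 0 (insub x).
  exists (ext c1, ext c2) => _ x y xC yC; rewrite /ext /= !insubT /=.
  split=> [e1 e2 | ]; last by rewrite -cE.
  by have /(congr1 val) := c_inj _ _ e1 e2.
pose q (k : H -> nat) x := [set y in comp x | k y == k x].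
have comp_eq x y : (y \in comp x) = (comp x == comp y).
  have conn_sym := sym_connect_sym (@edge_sym H).
  apply/idP/eqP => [|->]; last by rewrite inE connect0.
  by rewrite inE => xy; apply/setP => z; rewrite !inE (same_connect conn_sym xy).
have qE (k : {set H} -> H -> nat) x y : (q (k (comp x)) x == q (k (comp y)) y) =
    (comp x == comp y) && (k (comp x) x == k (comp x) y).
  apply/eqP/andP => [qxy | [/eqP xy /eqP kxy]]; last first.
    by rewrite /q -xy -kxy.
  have : y \in q (k (comp x)) x by rewrite qxy !inE connect0 eqxx.
  by rewrite inE comp_eq [k _ y == _]eq_sym => /andP[].
exists (fun x => q (c (comp x)).1 x), (fun x => q (c (comp x)).2 x).
have compH x : comp x \in components H by apply/imsetP; exists x.
split=> [x y /eqP | x y]; rewrite (qE (fun C => (c C).1)).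
  case/andP=> /eqP xy /eqP e1 /eqP; rewrite (qE (fun C => (c C).2)).
  case/andP=> _ /eqP e2.
  by have [||c_inj _] := cP _ (compH x) x y; rewrite ?comp_eq ?xy //; apply: c_inj.
rewrite (qE (fun C => (c C).2)); case: eqP => [xy | /eqP not_xy] /=.
  by have [||_ ->] := cP _ (compH x) x y; rewrite ?comp_eq ?xy.
by apply: contraNF not_xy => xy; rewrite -comp_eq inE connect1.
Qed.

(** * Realization of line graphs as shortest path graphs *)

Section LineGraphRealization.
Variables (H : sgraph) (T : finType) (c1 c2 : H -> T).
Hypothesis cP : bipartite_line_graph c1 c2.

(* [inl false] and [inl true] are the ends of the geodesics, and the two copies
   of [T] are the sides of the bipartite graph. *)
Let V : finType := (bool + (T + T))%type.

Let arc : rel V := fun x y => match x, y with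
  | inl false, inr (inl _) => true
  | inr (inl u), inr (inr v) => [exists e, (c1 e == u) && (c2 e == v)]
  | inr (inr _), inl true => true
  | _, _ => false end.

Let adj : rel V := fun x y => arc x y || arc y x.

Let adj_sym : symmetric adj. Proof. by move=> x y; rewrite /adj orbC. Qed.

Let adj_irr : irreflexive adj.
Proof. by case=> [[]|[]]. Qed.

Let G : sgraph := SGraph adj_sym adj_irr.
Let a : G := inl false.
Let b : G := inl true.
Let geo (e : H) : seq G := [:: a; inr (inl (c1 e)); inr (inr (c2 e)); b].

Let geo_path (e : H) : ab_path a b (geo e).
Proof.
rewrite /= /adj /= andbT; apply/andP; split=> //.
by rewrite orbF; apply/existsP; exists e; rewrite !eqxx.
Qed.

(** The bound on the size replaces [geodesic] because the distance is not yet known; its value is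
    deduced from this fact. *)
Let short_path_geo (s : seq G) : ab_path a b s -> size s <= 4 -> exists e, s = geo e.
Proof.
case: s => // x p /and4P[/eqP-> /eqP last_p p_path _] {x}.
case: p last_p p_path => [|y [|z [|w [|]]]] //=.
- by move=> -> /andP[].
- by move=> ->; case: y => [[]|[]].
move=> -> /and4P[ay yz zb _] _; case: y ay yz => [[]|[u|u]] //= _.
case: z zb => [[]|[v|v]] //= _; rewrite /adj /= orbF.
by case/existsP=> e /andP[/eqP<- /eqP<-]; exists e.
Qed.

Lemma realize_line_graph : 0 < #|H| -> is_shortest_path_graph H.
Proof.
case/card_gt0P=> e0 _; exists G, a, b; split=> //.
have le3 : dist a b <= 3 by apply: dist_le (geo_path e0).
have geo_of s : geodesic a b s -> exists e, s = geo e.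
  move=> s_geo; apply: short_path_geo; first by case/andP: s_geo.
  by rewrite (geodesic_size s_geo).
(* Some geodesic exists and has the form [geo e], hence four vertices. *)
have dist3 : dist a b = 3.
  have [s s_geo] := ex_geodesic (geo_path e0); have [e def_s] := geo_of s s_geo.
  by have := geodesic_size s_geo; rewrite def_s => -[].
have geo_geodesic e : geodesic a b (geo e) by rewrite /geodesic geo_path dist3.
have geo_size e := geodesic_leq_card (geo_geodesic e).
apply: isomorphic_sym.
exists (fun e => exist (fun s : #|G|.-bseq G => geodesic a b s)
                   (Bseq (geo_size e)) (geo_geodesic e)).
  apply: inj_surj_bij => [e f /(congr1 val)/(congr1 val)[e1 e2] | [s s_geo]].
    by case: cP => c_inj _; apply: c_inj.
  by have [e def_s] := geo_of _ s_geo; exists e; do 2!apply: val_inj.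
(* Only the two inner positions can differ, and exactly one does when the exclusive or holds. *)
move=> e f; case: cP => _ ->; rewrite /= /spg_edge /= /num_diff /=.
rewrite !(inj_eq inr_inj) (inj_eq inl_inj).
by case: (c1 e == c1 f); case: (c2 e == c2 f).
Qed.

End LineGraphRealization.

(** Two isolated vertices have no geodesic between them. The case is separate because
    [realize_line_graph] obtains the distance from a vertex of [H]. *)
Lemma empty_shortest_path_graph (H : sgraph) : #|H| = 0 -> is_shortest_path_graph H.
Proof.
move=> H0; pose G := SGraph (vertex := bool) (edge := fun _ _ => false)
  (fun _ _ => erefl) (fun _ => erefl).
have no_geo s : ~~ geodesic (false : G) true s.
  by case: s => // -[] [|y p]; rewrite /geodesic /= ?andbF.
have notH (x : H) : False by have := card0_eq H0 x; rewrite !inE.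
exists G, false, true; split=> //.
have no_vertex (s : shortest_path_graph (false : G) true) : False.
  by case: s => s; apply/negP.
exists (fun s => match no_vertex s return H with end).
  by apply: inj_surj_bij => [s | y]; [case: (no_vertex s) | case: (notH y)].
by move=> s; case: (no_vertex s).
Qed.

(** * The characterization *)

Theorem theorem22 (H : sgraph) (girthH : girth_geq H 5) :
  is_shortest_path_graph H <->
  (forall C : {set H}, C \in components H -> 1 < #|C| ->
     (exists n : nat, isomorphic (induced C) (path_graph n)) \/
     (exists n : nat, [/\ ~~ odd n, 5 < n
                        & isomorphic (induced C) (cycle_graph n)])).
Proof.
split=> [spgH C /imsetP[x0 _ ->] _ | compH].
  have [col colP] := spg_edge_2coloring girthH spgH.
  have [|[c [/(cycle_size_ge5 girthH) c_ge5 c_even iso]]] :=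
    component_path_or_cycle colP x0; [by left | right].
  (* The girth gives length at least 5, and evenness excludes 5. *)
  exists (size c); split=> //; rewrite ltn_neqAle c_ge5 andbT.
  by apply: contraNneq c_even => <-.
case: (posnP #|H|) => [/empty_shortest_path_graph // | H_gt0].
suff [c1 [c2 c12]] : exists c1 c2 : H -> {set H}, bipartite_line_graph c1 c2.
  exact: realize_line_graph c12 H_gt0.
apply: bipartite_line_graph_glue => C C_comp; case: (ltnP 1 #|C|) => [C_gt1 | C_le1].
  case: (compH C C_comp C_gt1) => -[n].
    by move=> iso; apply: bipartite_line_graph_iso iso (path_graph_line n).
  case=> n_even n_gt5 iso; apply: bipartite_line_graph_iso iso _.
  by apply: cycle_graph_line => //; apply: leq_trans n_gt5.
(* A trivial component corresponds to a single edge, so constant labels suffice. *)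
have C_eq (x y : induced C) : x = y.
  by apply: val_inj; apply: (card_le1_eqP C_le1); apply: valP.
exists (fun=> 0), (fun=> 0); split=> x y; first by move=> _ _; apply: C_eq.
by rewrite (C_eq x y) edge_irr.
Qed.
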